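(* In the setting given in the context, the map $(\alpha,\xi)\mapsto k(\alpha,\xi)$ is a bijection from $\mathcal{A}$ to $\mathcal{K}$. Its inverse is $\kappa\mapsto(\alpha(\kappa),\xi(\kappa))$ with $$\alpha_i(\kappa_i)\triangleq\frac{1}{\sqrt{1+\kappa_i^2}},\qquad \xi_i(\kappa_i)\triangleq\operatorname{sign}(\kappa_i),\qquad i\in\{1,\dots,n\},$$ where $\operatorname{sign}(0)=0$. If $(\alpha,\xi)\in\mathcal{A}$ and $\kappa=k(\alpha,\xi)$, then $$\mathcal{P}(\alpha,\xi)=\mathcal{P}(\kappa)\qquad\text{and}\qquad w(p,(\alpha,\xi))=\tilde w(p,\kappa)$$ for every $p$ in this common set.
   Context: Let $n\ge 1$, and let $R,X\in\mathbb{R}^{n\times n}$ be arbitrary fixed matrices. Let $\underline{m},\overline{m},m^\bullet\in\mathbb{R}^n$ satisfy $\underline{m}\le 0\le\overline{m}$ and $\underline{m}\le m^\bullet\le\overline{m}$ componentwise, and let $\underline{\alpha}\in\mathbb{R}^n$ with $0<\underline{\alpha}_i\le 1$ for all $i$. Vector inequalities are componentwise. Let $\mathcal{P}\triangleq[0,1]^n$. For $\alpha_i\in(0,1]$ and $\xi_i\in\{-1,0,1\}$ put $k(\alpha_i,\xi_i)\triangleq\frac{\xi_i}{\alpha_i}\sqrt{1-\alpha_i^2}$, and for vectors write $k(\alpha,\xi)\in\mathbb{R}^n$ for the vector with entries $k(\alpha_i,\xi_i)$. Let $S(\alpha,\xi)\triangleq R+X\operatorname{diag}(k(\alpha,\xi))$.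 The set $\mathcal{A}$ consists of all $(\alpha,\xi)\in(0,1]^n\times\{-1,0,1\}^n$ such that $\underline{\alpha}\le\alpha\le\mathbf{1}$; for each $i$, $\xi_i\in\{-1,1\}$ if $\alpha_i<1$ and $\xi_i=0$ if $\alpha_i=1$; and $\underline{m}\le S(\alpha,\xi)p'\le\overline{m}$ for all $p'\in\mathcal{P}$. The paper assumes that $\mathcal{A}$ is nonempty. For $(\alpha,\xi)\in\mathcal{A}$, let $$\mathcal{P}(\alpha,\xi)\triangleq\{p\in\mathcal{P}:(1+k(\alpha_i,\xi_i)^2)p_i^2\le 1\ \ \forall i\},$$ and for $p\in\mathcal{P}(\alpha,\xi)$ let $w(p,(\alpha,\xi))\triangleq\|m^\bullet-S(\alpha,\xi)p\|_1$. For $\kappa\in\mathbb{R}^n$ set $\tilde S(\kappa)\triangleq R+X\operatorname{diag}(\kappa)$ and $\mathcal{P}(\kappa)\triangleq\prod_{i=1}^n\left[0,\frac{1}{\sqrt{1+\kappa_i^2}}\right]$. Define $$\mathcal{K}\triangleq\left\{\kappa\in\mathbb{R}^n:\ |\kappa_i|\le\frac{\sqrt{1-\underline{\alpha}_i^2}}{\underline{\alpha}_i}\ \forall i,\ \ \underline{m}\le\tilde S(\kappa)p'\le\overline{m}\ \ \forall p'\in\mathcal{P}\right\},$$ and for $\kappa\in\mathcal{K}$, $p\in\mathcal{P}(\kappa)$ let $\tilde w(p,\kappa)\triangleq\|m^\bullet-\tilde S(\kappa)p\|_1$. *)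

(* Defs.v *)
From mathcomp Require Import all_boot all_order all_algebra.
From mathcomp Require Import boolp classical_sets functions reals.

Set Implicit Arguments.
Unset Strict Implicit.
Unset Printing Implicit Defensive.

Import Order.TTheory GRing.Theory Num.Theory.

Local Open Scope classical_set_scope.
Local Open Scope ring_scope.

(* Vectors of R^n are column vectors; a pair (alpha, xi) is an element of
   'cV[R]_n * 'cV[R]_n. *)
Section Vectors.
Variables (R : realType) (n : nat).

Definition vle (u v : 'cV[R]_n) : Prop := forall i, u i 0 <= v i 0.

Definition l1norm (v : 'cV[R]_n) : R := \sum_i `|v i 0|.

Definition unit_box : set 'cV[R]_n := [set p : 'cV[R]_n | forall i, 0 <= p i 0 <= 1].

End Vectors.

Section AlphaXi.
Variables (R : realType) (n : nat).
Variables (Rm X : 'M[R]_n) (mlo mhi mb alo : 'cV[R]_n).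

Definition kfun (a x : R) : R := x / a * Num.sqrt (1 - a ^+ 2).

(* The maps below are total; the restrictions alpha_i in ]0, 1] and
   xi_i in {-1, 0, 1} on their arguments are imposed in calA. *)
Definition kvec (ax : 'cV[R]_n * 'cV[R]_n) : 'cV[R]_n :=
  \col_i kfun (ax.1 i 0) (ax.2 i 0).

Definition Smx (ax : 'cV[R]_n * 'cV[R]_n) : 'M[R]_n :=
  Rm + X *m diag_mx (kvec ax)^T.

Definition calA : set ('cV[R]_n * 'cV[R]_n) := [set ax : 'cV[R]_n * 'cV[R]_n |
  [/\ forall i, 0 < ax.1 i 0 <= 1,
      forall i, ax.2 i 0 \in [:: -1; 0; 1],
      vle alo ax.1 /\ vle ax.1 (const_mx 1),
      forall i, (ax.1 i 0 < 1 -> ax.2 i 0 \in [:: -1; 1]) /\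
                (ax.1 i 0 = 1 -> ax.2 i 0 = 0)
    & forall p', unit_box p' ->
        vle mlo (Smx ax *m p') /\ vle (Smx ax *m p') mhi]].

Definition Pax (ax : 'cV[R]_n * 'cV[R]_n) : set 'cV[R]_n := [set p : 'cV[R]_n |
  unit_box p /\
  forall i, (1 + kfun (ax.1 i 0) (ax.2 i 0) ^+ 2) * p i 0 ^+ 2 <= 1].

Definition w (p : 'cV[R]_n) (ax : 'cV[R]_n * 'cV[R]_n) : R :=
  l1norm (mb - Smx ax *m p).

End AlphaXi.

Section Kappa.
Variables (R : realType) (n : nat).
Variables (Rm X : 'M[R]_n) (mlo mhi mb alo : 'cV[R]_n).

Definition Stilde (kappa : 'cV[R]_n) : 'M[R]_n := Rm + X *m diag_mx kappa^T.

Definition Pkappa (kappa : 'cV[R]_n) : set 'cV[R]_n := [set p : 'cV[R]_n |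
  forall i, 0 <= p i 0 <= 1 / Num.sqrt (1 + kappa i 0 ^+ 2)].

Definition calK : set 'cV[R]_n := [set kappa : 'cV[R]_n |
  (forall i, `|kappa i 0| <= Num.sqrt (1 - alo i 0 ^+ 2) / alo i 0) /\
  (forall p', unit_box p' ->
     vle mlo (Stilde kappa *m p') /\ vle (Stilde kappa *m p') mhi)].

Definition wtilde (p kappa : 'cV[R]_n) : R := l1norm (mb - Stilde kappa *m p).

Definition alpha_of (kappa : 'cV[R]_n) : 'cV[R]_n :=
  \col_i (1 / Num.sqrt (1 + kappa i 0 ^+ 2)).

Definition xi_of (kappa : 'cV[R]_n) : 'cV[R]_n := \col_i Num.sg (kappa i 0).

End Kappa.

(* Main.v *)
Require Import Defs.
From mathcomp Require Import all_boot all_order all_algebra.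
From mathcomp Require Import boolp classical_sets functions reals.
From mathcomp Require Import ring.

Set Implicit Arguments.
Unset Strict Implicit.
Unset Printing Implicit Defensive.

Import Order.TTheory GRing.Theory Num.Theory.

Local Open Scope classical_set_scope.
Local Open Scope ring_scope.

(* With s = sqrt(1 + k^2), the substitution alpha = 1/s turns sqrt(1 - alpha^2)
   into |k|/s, so that k(alpha, sign k) = sign(k) |k| = k.  Conversely
   1 + k(alpha, xi)^2 = alpha^-2 as soon as xi^2 = 1 or alpha = 1.  Everything is
   coordinatewise, and both matrices S and tilde S depend on k only. *)

Section Scalar.
Variable R : realType.
Implicit Types a b k p x : R.

Lemma sqrt_1Dsqr_gt0 k : 0 < Num.sqrt (1 + k ^+ 2).
Proof. by rewrite sqrtr_gt0 ltr_pwDl ?sqr_ge0. Qed.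

Lemma sqr_sqrt_1Dsqr k : Num.sqrt (1 + k ^+ 2) ^+ 2 = 1 + k ^+ 2.
Proof. by rewrite sqr_sqrtr// addr_ge0 ?sqr_ge0. Qed.

Lemma inv_sqrt_1Dsqr_le1 k : 1 / Num.sqrt (1 + k ^+ 2) <= 1.
Proof.
rewrite ler_pdivrMr ?sqrt_1Dsqr_gt0// mul1r.
by rewrite -[leLHS]sqrtr1 ler_wsqrtr// lerDl sqr_ge0.
Qed.

(** Equality with 1 forces the root to be 1, and squaring then gives [k = 0]. This matches the case
    split on [alpha] in [calA] with the sign of [kappa]. *)
Lemma inv_sqrt_1Dsqr_lt1 k : (1 / Num.sqrt (1 + k ^+ 2) < 1) = (k != 0).
Proof.
rewrite lt_neqAle inv_sqrt_1Dsqr_le1 andbT; congr (~~ _).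
rewrite div1r invr_eq1; apply/eqP/eqP => [s1|->]; last first.
  by rewrite expr0n addr0 sqrtr1.
have := sqr_sqrt_1Dsqr k; rewrite s1 expr1n => /eqP.
by rewrite eq_sym -subr_eq0 addrAC subrr add0r sqrf_eq0 => /eqP.
Qed.

Lemma kfun_inv_sqrt_1Dsqr k :
  kfun (1 / Num.sqrt (1 + k ^+ 2)) (Num.sg k) = k.
Proof.
have s0 := sqrt_1Dsqr_gt0 k; have sE := sqr_sqrt_1Dsqr k; rewrite /kfun.
set s := Num.sqrt (1 + k ^+ 2) in s0 sE *.
have sn0 : s != 0 by rewrite gt_eqF.
have -> : 1 - (1 / s) ^+ 2 = (k / s) ^+ 2.
  have -> : 1 - (1 / s) ^+ 2 = (s ^+ 2 - 1) / s ^+ 2 by field.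
  by rewrite sE addrAC subrr add0r expr_div_n sE.
rewrite sqrtr_sqr normf_div (gtr0_norm s0) invf_div divr1.
by rewrite -mulrA (mulrCA s) divff// mulr1 -numEsg.
Qed.

(** The hypothesis on [x ^+ 2] states both regimes at once. For [a < 1] the sum is 1 + (1 -
    a^2)/a^2; for [a = 1] the root vanishes and both sides are 1. *)
Lemma sqr_kfun a x : 0 < a <= 1 -> x ^+ 2 = (a < 1)%R%:R ->
  1 + kfun a x ^+ 2 = a ^- 2.
Proof.
move=> /andP[a0 a1] x2.
have an0 : a != 0 by rewrite gt_eqF.
have a2 : 0 <= 1 - a ^+ 2 by rewrite subr_ge0 expr_le1// ltW.
rewrite /kfun exprMn sqr_sqrtr// expr_div_n x2.
move: a1; rewrite le_eqVlt => /orP[/eqP ->|->] /=; last by field.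
by rewrite expr1n subrr mulr0 addr0 invr1.
Qed.

Lemma inv_sqrt_1Dsqr_kfun a x : 0 < a <= 1 -> x ^+ 2 = (a < 1)%R%:R ->
  1 / Num.sqrt (1 + kfun a x ^+ 2) = a.
Proof.
move=> ha hx; have /andP[a0 _] := ha.
by rewrite sqr_kfun// -exprVn sqrtr_sqr gtr0_norm ?invr_gt0// div1r invrK.
Qed.

(** For [a < 1] the factors multiplying [x] are positive; for [a = 1] the hypothesis forces
    [x = 0]. *)
Lemma sg_kfun a x : 0 < a <= 1 -> x ^+ 2 = (a < 1)%R%:R ->
  Num.sg (kfun a x) = Num.sg x.
Proof.
move=> /andP[a0 _] x2; rewrite /kfun !sgrM sgrV (gtr0_sg a0) mulr1.
have [a1|a1] := boolP (a < 1).
  by rewrite [X in _ * X]gtr0_sg ?mulr1// sqrtr_gt0 subr_gt0 expr_lt1// ltW.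
move: x2; rewrite (negbTE a1) => /eqP; rewrite sqrf_eq0 => /eqP ->.
by rewrite sgr0 mul0r.
Qed.

(** After clearing denominators and squaring nonnegative quantities, both sides say b^2 (1 + k^2) <=
    1. With [b] an entry of [alo], the bound in [calK] becomes the lower bound on [alpha]. *)
Lemma ler_norm_inv_sqrt_1Dsqr b k : 0 < b <= 1 ->
  (`|k| <= Num.sqrt (1 - b ^+ 2) / b) = (b <= 1 / Num.sqrt (1 + k ^+ 2)).
Proof.
move=> /andP[b0 b1].
have b2 : 0 <= 1 - b ^+ 2 by rewrite subr_ge0 expr_le1// ltW.
rewrite ler_pdivlMr// -ler_sqr ?nnegrE ?mulr_ge0 ?sqrtr_ge0//; last exact: ltW.
rewrite sqr_sqrtr// exprMn -normrX ger0_norm ?sqr_ge0//.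
rewrite ler_pdivlMr ?sqrt_1Dsqr_gt0// -[RHS]ler_sqr ?nnegrE//; last first.
  by rewrite mulr_ge0 ?sqrtr_ge0// ltW.
by rewrite exprMn sqr_sqrt_1Dsqr expr1n mulrDr mulr1 lerBrDl (mulrC (k ^+ 2)).
Qed.

(** With s the root, the left side is (s p)^2 <= 1, which for s p >= 0 means s p <= 1. *)
Lemma sqr_le1_inv_sqrt_1Dsqr k p : 0 <= p ->
  ((1 + k ^+ 2) * p ^+ 2 <= 1) = (p <= 1 / Num.sqrt (1 + k ^+ 2)).
Proof.
move=> p0; rewrite ler_pdivlMr ?sqrt_1Dsqr_gt0// -sqr_sqrt_1Dsqr -exprMn.
by rewrite sqr_sqrt_1Dsqr mulrC expr_le1// mulr_ge0// sqrtr_ge0.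
Qed.

Lemma sgr_sign_triple x : x \in [:: -1; 0; 1] -> Num.sg x = x.
Proof.
rewrite !inE => /or3P[] /eqP ->; first by rewrite sgrN1.
- exact: sgr0.
- exact: sgr1.
Qed.

End Scalar.

Section Vector.
Variables (R : realType) (n : nat).
Variables (Rm X : 'M[R]_n) (mlo mhi alo : 'cV[R]_n).
Implicit Types (kappa : 'cV[R]_n) (ax : 'cV[R]_n * 'cV[R]_n).

(** Folds the two implications on [xi] into the single equation that the scalar lemmas take as
    hypothesis. *)
Lemma calA_sqr_xi ax i : calA Rm X mlo mhi alo ax ->
  ax.2 i 0 ^+ 2 = (ax.1 i 0 < 1)%R%:R.
Proof.
case=> ha _ _ hx _; have [hlt heq] := hx i.
have /andP[_] := ha i; rewrite le_eqVlt => /orP[/eqP a1|a1].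
  by rewrite heq// a1 ltxx expr0n.
by have := hlt a1; rewrite !inE a1 => /orP[] /eqP ->; rewrite ?sqrrN expr1n.
Qed.

Lemma kvecK kappa : kvec (alpha_of kappa, xi_of kappa) = kappa.
Proof. by apply/colP => i; rewrite !mxE kfun_inv_sqrt_1Dsqr. Qed.

Lemma alpha_of_xi_ofK ax : calA Rm X mlo mhi alo ax ->
  (alpha_of (kvec ax), xi_of (kvec ax)) = ax.
Proof.
move=> hax; have [ha hx _ _ _] := hax; case: ax hax ha hx => a x hax ha hx.
congr pair; apply/colP => i; rewrite !mxE.
- by apply: inv_sqrt_1Dsqr_kfun; [exact: ha|exact: (calA_sqr_xi i hax)].
- rewrite sg_kfun; first exact/sgr_sign_triple/hx.
  + exact: ha.
  + exact: (calA_sqr_xi i hax).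
Qed.

Lemma Pax_Pkappa ax : Pax ax = Pkappa (kvec ax).
Proof.
apply/seteqP; split=> p /=.
  move=> [hp hk] i; have /andP[p0 _] := hp i.
  by rewrite p0 mxE -sqr_le1_inv_sqrt_1Dsqr//; exact: hk.
move=> hp; split=> i; have /andP[p0 pk] := hp i.
  (* The upper bound of the unit box follows because 1 / sqrt(1 + k^2) never exceeds 1. *)
  by rewrite p0 (le_trans pk) ?inv_sqrt_1Dsqr_le1.
by rewrite sqr_le1_inv_sqrt_1Dsqr//; move: pk; rewrite mxE.
Qed.

Hypothesis halo : forall i, 0 < alo i 0 <= 1.

Lemma calK_kvec ax :
  calA Rm X mlo mhi alo ax -> calK Rm X mlo mhi alo (kvec ax).
Proof.
(* [Smx ax] and [Stilde (kvec ax)] are convertible, so the box constraint carries over as it stands;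
   only the bound on each entry remains. *)
move=> hax; have [ha _ [hlo _] _ hS] := hax; split=> [i|//].
rewrite ler_norm_inv_sqrt_1Dsqr// mxE inv_sqrt_1Dsqr_kfun//.
exact: calA_sqr_xi.
Qed.

Lemma calA_alpha_of_xi_of kappa : calK Rm X mlo mhi alo kappa ->
  calA Rm X mlo mhi alo (alpha_of kappa, xi_of kappa).
Proof.
move=> [hk hS]; split=> /=.
- by move=> i; rewrite mxE inv_sqrt_1Dsqr_le1 andbT divr_gt0 ?sqrt_1Dsqr_gt0.
- by move=> i; rewrite mxE !inE; case: sgrP; rewrite eqxx ?orbT.
- split=> i; rewrite !mxE ?inv_sqrt_1Dsqr_le1//.
  by rewrite -ler_norm_inv_sqrt_1Dsqr.
- move=> i; rewrite !mxE; split.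
    rewrite inv_sqrt_1Dsqr_lt1 => k0.
    by rewrite !inE; case: sgrP k0 => // _ _; rewrite eqxx ?orbT.
  (* When [alpha] is 1 the strict inequality fails, so the entry of [kappa] is zero and so is its
     sign. *)
  move=> a1; have := inv_sqrt_1Dsqr_lt1 (kappa i 0).
  by rewrite a1 ltxx => /esym/negbFE/eqP ->; rewrite sgr0.
- by rewrite /Smx kvecK.
Qed.

End Vector.

Theorem lemma2 (R : realType) (n : nat) (hn : (1 <= n)%N)
    (Rm X : 'M[R]_n) (mlo mhi mb alo : 'cV[R]_n)
    (hmlo : vle mlo 0) (hmhi : vle 0 mhi)
    (hmb : vle mlo mb /\ vle mb mhi)
    (halo : forall i, 0 < alo i 0 <= 1)
    (hA : calA Rm X mlo mhi alo !=set0) :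
  [/\ set_bij (calA Rm X mlo mhi alo) (calK Rm X mlo mhi alo) (@kvec R n),
      (forall kappa, calK Rm X mlo mhi alo kappa ->
         calA Rm X mlo mhi alo (alpha_of kappa, xi_of kappa) /\
         kvec (alpha_of kappa, xi_of kappa) = kappa),
      (forall alpha xi, calA Rm X mlo mhi alo (alpha, xi) ->
         (alpha_of (kvec (alpha, xi)), xi_of (kvec (alpha, xi))) = (alpha, xi))
    & forall alpha xi kappa, calA Rm X mlo mhi alo (alpha, xi) ->
        kappa = kvec (alpha, xi) ->
        Pax (alpha, xi) = Pkappa kappa /\
        forall p, Pkappa kappa p ->
          w Rm X mb p (alpha, xi) = wtilde Rm X mb p kappa].
Proof.
split.
- split.
  + by move=> ax; exact: calK_kvec.
  (* Injectivity comes from the left inverse, available only on [calA]. *)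
  + move=> ax ay /set_mem hax /set_mem hay kE.
    by rewrite -(alpha_of_xi_ofK hax) kE (alpha_of_xi_ofK hay).
  + move=> kappa hk; exists (alpha_of kappa, xi_of kappa); last exact: kvecK.
    exact: calA_alpha_of_xi_of.
- by move=> kappa hk; split; [exact: calA_alpha_of_xi_of|exact: kvecK].
- by move=> a x; exact: alpha_of_xi_ofK.
(* Once [kappa] is replaced by [kvec], the two objectives agree by unfolding. *)
- by move=> a x kappa _ ->; split; first exact: Pax_Pkappa.
Qed.
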